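(* For sufficiently large $n$, any data structure (encoding) built from an array $A[1..n]$ from which the answers to all range minimum and all range maximum queries on $A$ can be recovered must occupy at least $3n - \Theta(\log n)$ bits.
   Context: A range minimum (resp. maximum) query on $A[i..j]$, $1\le i\le j\le n$, returns the index of the minimum (resp. maximum) element of $A[i..j]$. The bound is a worst-case bound over arrays of length $n$, i.e. it concerns the number of bits needed to distinguish all arrays that have different answers to some such query. *)

(* Defs.v *)
From HB Require Import structures.
From mathcomp Require Import all_boot all_order all_algebra.
From mathcomp Require Import all_classical all_reals all_analysis.

Set Implicit Arguments.
Unset Strict Implicit.
Unset Printing Implicit Defensive.

Import Order.TTheory GRing.Theory Num.Theory.
Import numFieldNormedType.Exports.

(* Indices are 0-based. With ties in A, a range has several minimum positions
   (resp. maximum positions) and each of them is an admissible answer, so that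
   no tie-breaking convention is imposed on an encoding. *)
Definition range_min (d : Order.disp_t) (T : orderType d) (n : nat)
    (A : n.-tuple T) (i j k : 'I_n) : Prop :=
  (i <= k <= j)%N /\
  forall l : 'I_n, (i <= l <= j)%N -> (tnth A k <= tnth A l)%O.

Definition range_max (d : Order.disp_t) (T : orderType d) (n : nat)
    (A : n.-tuple T) (i j k : 'I_n) : Prop :=
  (i <= k <= j)%N /\
  forall l : 'I_n, (i <= l <= j)%N -> (tnth A l <= tnth A k)%O.

(* The query algorithms depend on n and see only the bits enc A, not A. *)
Definition range_min_max_encoding (d : Order.disp_t) (T : orderType d) (n : nat)
    (enc : n.-tuple T -> seq bool) : Prop :=
  exists qmin qmax : seq bool -> 'I_n -> 'I_n -> 'I_n,
  forall (A : n.-tuple T) (i j : 'I_n), (i <= j)%N ->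
    range_min A i j (qmin (enc A) i j) /\ range_max A i j (qmax (enc A) i j).

(* Main.v *)
Require Import Defs.
From HB Require Import structures.
From mathcomp Require Import all_boot all_order all_algebra.
From mathcomp Require Import all_classical all_reals all_analysis.
From mathcomp Require Import zify.

(** Baxter permutations grow by inserting a new maximum just left of a
left-to-right maximum or just right of a right-to-left maximum. Range minimum
and maximum answers determine such a permutation: they locate the maximum, the
minimum of the three cells around it tells on which side its guarding record
lies, and that record answers all maximum queries across the removed cell, so
one can recurse. An encoding is therefore injective on Baxter permutations.

The permutations with [x + 1] left-to-right and [y + 1] right-to-left maxima
have children [(a, y + 1)] for [a <= x] and [(x + 1, b)] for [b <= y]. A
binomial transform turns this generating tree into triples of weakly
non-crossing lattice paths with gaps [(j, k)], whose transfer operator [K] is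
symmetric and has the Vandermonde product [h] as a positive eigenfunction for
the eigenvalue [8]. If [Z m] counts the ways to close the gaps in [m] steps,
then [<Z m, h> = 8 ^ m h(0,0)] and [Z (2 m) (0,0) = <Z m, Z m>], so
Cauchy-Schwarz on a box of polynomial size leaves at least
[64 ^ m / poly m] closed triples of length [2 m]. *)

Set Implicit Arguments.
Unset Strict Implicit.
Unset Printing Implicit Defensive.

Import Order.TTheory GRing.Theory Num.Theory.
Import numFieldNormedType.Exports.

(** * Counting walks in the generating tree *)

(** Number of descendants [N] generations below a node [(x, y)] of the generating tree. *)
Fixpoint walks N x y : nat :=
  if N is N'.+1 then
    \sum_(a < x.+1) walks N' a y.+1 + \sum_(b < y.+1) walks N' x.+1 b
  else 1.

Definition backshift (f : nat -> nat) j := if j is j'.+1 then f j' else 0.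

(** [S] and [P] stand for successor and predecessor, the digit for the shifted gap. [addS1] and
    [addP1] are transposes up to boundary terms, as are [addS2] and [addP2]. *)
Definition addS1 (f : nat -> nat -> nat) j k := f j k + f j.+1 k.
Definition addS2 (f : nat -> nat -> nat) j k := f j k + f j k.+1.
Definition addP1 (f : nat -> nat -> nat) j k := f j k + backshift (f^~ k) j.
Definition addP2 (f : nat -> nat -> nat) j k := f j k + backshift (f j) k.

Definition transfer f j k := addP1 (addS2 f) j k + addP2 (addS1 f) j k.

(* [path_triples N j k]: ways to continue three lattice paths with gaps [j]
   (lower to middle) and [k] (middle to upper) by [N] steps each without
   crossing, so that they end at a common point. In [transfer], the first
   summand is an east step of the middle path, the second a north step. *)
Definition path_triples N : nat -> nat -> nat :=
  iter N transfer (fun j k => ((j == 0) && (k == 0) : nat)).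

Lemma path_triplesS N : path_triples N.+1 = transfer (path_triples N).
Proof. by []. Qed.

(** * The binomial transform from walks to path triples *)

Definition binom_transform (g : nat -> nat) x := \sum_(j < x.+1) 'C(x, j) * g j.

Lemma eq_binom_transform g h x : g =1 h -> binom_transform g x = binom_transform h x.
Proof. by move=> gh; apply: eq_bigr => j _; rewrite gh. Qed.

Lemma binom_transformD g h x :
  binom_transform (fun j => g j + h j) x = binom_transform g x + binom_transform h x.
Proof. by rewrite -big_split; apply: eq_bigr => j _; rewrite /= mulnDr. Qed.

Lemma binom_transformS g x :
  binom_transform g x.+1 = binom_transform (fun j => g j + g j.+1) x.
Proof.
rewrite binom_transformD [LHS]big_ord_recl /= bin0.
under eq_bigr => i _ do rewrite /bump /= add1n binS mulnDl.
rewrite big_split /= addnA; congr (_ + _).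
rewrite -(bin0 x) -(big_ord_recl x.+1 (fun i => 'C(x, i) * g i)) big_ord_recr /=.
by rewrite bin_small // mul0n addn0.
Qed.

Lemma sum_bin_hockey x j : \sum_(a < x.+1) 'C(a, j) = 'C(x.+1, j.+1).
Proof.
elim: x => [|x IH]; first by rewrite big_ord1 binS /= [in RHS]bin0n.
by rewrite big_ord_recr /= IH -binS.
Qed.

Lemma binom_transform_wide g x M : x < M ->
  binom_transform g x = \sum_(j < M) 'C(x, j) * g j.
Proof.
move=> xM; rewrite /binom_transform -!(big_mkord xpredT (fun j => 'C(x, j) * g j)).
rewrite [RHS](@big_cat_nat _ _ _ x.+1) //= -[LHS]addn0; congr (_ + _).
by rewrite big_nat big1 // => j /andP[xj _]; rewrite bin_small.
Qed.

(** The hockey-stick identity sums ['C(a, j)] to ['C(x.+1, j.+1)], which Pascal's rule splits into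
    the coefficients of [g] and of its backshift. *)
Lemma sum_binom_transform g x :
  \sum_(a < x.+1) binom_transform g a =
  binom_transform (fun j => g j + backshift g j) x.
Proof.
under eq_bigr => a _ do rewrite (binom_transform_wide _ (ltn_ord a)).
rewrite exchange_big /=.
under eq_bigr => j _ do rewrite -big_distrl /= sum_bin_hockey binS mulnDl.
rewrite big_split binom_transformD addnC /=; congr (_ + _).
rewrite /binom_transform [RHS]big_ord_recl /= muln0 add0n big_ord_recr /=.
by rewrite bin_small // mul0n addn0.
Qed.

(** On coefficients, a successor acts as [addS] and a prefix sum as [addP], so the recursion of
    [walks] becomes [transfer]. *)
Lemma walks_triples N x y :
  walks N x y = binom_transform (fun j => binom_transform (path_triples N j) y) x.
Proof.
elim: N x y => [|N IH] x y /=.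
  rewrite /binom_transform big_ord_recl [X in _ + X]big1 => [|i _].
    by rewrite big_ord_recl big1 ?bin0 // => i _; rewrite muln0.
  by rewrite big1 ?muln0 // => j _; rewrite muln0.
under eq_bigr => a _ do rewrite IH.
under [X in _ + X]eq_bigr => b _ do rewrite IH.
have -> : \sum_(b < y.+1)
      binom_transform (fun j => binom_transform (path_triples N j) b) x.+1 =
    binom_transform (fun j => binom_transform
      (fun k => path_triples N j k + backshift (path_triples N j) k) y) x.+1.
  rewrite exchange_big; apply: eq_bigr => j _ /=.
  by rewrite -big_distrr sum_binom_transform.
rewrite sum_binom_transform binom_transformS -binom_transformD.
apply: eq_binom_transform => j; rewrite -binom_transformD.
rewrite !binom_transformS.
have -> : backshift (fun j => binom_transform (path_triples N j) y.+1) j =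
    binom_transform (fun k => backshift
      (fun i => path_triples N i k + path_triples N i k.+1) j) y.
  case: j => [|j] /=; last by rewrite binom_transformS.
  by rewrite /binom_transform big1 // => i _; rewrite muln0.
rewrite -!binom_transformD; apply: eq_binom_transform => k.
rewrite /transfer /addP1 /addP2 /addS1 /addS2.
by case: k => [|k] /=; lia.
Qed.

(** One step changes each gap by at most one. *)
Lemma path_triples_small N j k : (N < j) || (N < k) -> path_triples N j k = 0.
Proof.
elim: N j k => [|N IH] j k H; first by case: j k H => [|j] [|k].
rewrite /path_triples iterS -/(path_triples N) /transfer /addP1 /addP2 /addS1 /addS2.
have Z j' k' : (N < j') || (N < k') -> path_triples N j' k' = 0 by exact: IH.
by case: j k H => [|j] [|k] H //=; rewrite !Z //; lia.
Qed.

(** * Symmetry and positive eigenfunction of the transfer operator *)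

Definition box_dot M (f g : nat -> nat -> nat) :=
  \sum_(j < M) \sum_(k < M) f j k * g j k.

Lemma sum_shift M (f g : nat -> nat) : f M = 0 ->
  \sum_(j < M) f j.+1 * g j = \sum_(j < M) f j * backshift g j.
Proof.
move=> fM; transitivity (\sum_(j < M.+1) f j * backshift g j).
  by rewrite big_ord_recl /= muln0 add0n.
by rewrite big_ord_recr /= fM mul0n addn0.
Qed.

Lemma sum_backshift M (f g : nat -> nat) : f M.-1 = 0 ->
  \sum_(j < M) backshift f j * g j = \sum_(j < M) f j * g j.+1.
Proof.
case: M => [|M] fM; first by rewrite !big_ord0.
rewrite big_ord_recl big_ord_recr /= fM !mul0n add0n addn0.
by apply: eq_bigr => j _.
Qed.

Lemma box_dotDl M f f' g :
  box_dot M (fun j k => f j k + f' j k) g = box_dot M f g + box_dot M f' g.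
Proof.
rewrite -big_split; apply: eq_bigr => j _; rewrite -big_split.
by apply: eq_bigr => k _; rewrite /= mulnDl.
Qed.

Lemma box_dotC M f g : box_dot M f g = box_dot M g f.
Proof. by apply: eq_bigr => j _; apply: eq_bigr => k _; rewrite mulnC. Qed.

Lemma box_dotDr M f g g' :
  box_dot M f (fun j k => g j k + g' j k) = box_dot M f g + box_dot M f g'.
Proof. by rewrite box_dotC box_dotDl !(box_dotC M f). Qed.

Lemma box_dot_addS1 M f g : (forall k, f M k = 0) ->
  box_dot M (addS1 f) g = box_dot M f (addP1 g).
Proof.
move=> fM; rewrite box_dotDl box_dotDr; congr (_ + _).
rewrite /box_dot exchange_big [RHS]exchange_big; apply: eq_bigr => k _ /=.
exact: (@sum_shift M (f^~ k) (g^~ k)).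
Qed.

Lemma box_dot_addS2 M f g : (forall j, f j M = 0) ->
  box_dot M (addS2 f) g = box_dot M f (addP2 g).
Proof.
move=> fM; rewrite box_dotDl box_dotDr; congr (_ + _).
by apply: eq_bigr => j _; exact: (@sum_shift M (f j) (g j)).
Qed.

Lemma box_dot_addP1 M f g : (forall k, f M.-1 k = 0) ->
  box_dot M (addP1 f) g = box_dot M f (addS1 g).
Proof.
move=> fM; rewrite box_dotDl box_dotDr; congr (_ + _).
rewrite /box_dot exchange_big [RHS]exchange_big; apply: eq_bigr => k _ /=.
exact: (@sum_backshift M (f^~ k) (g^~ k)).
Qed.

Lemma box_dot_addP2 M f g : (forall j, f j M.-1 = 0) ->
  box_dot M (addP2 f) g = box_dot M f (addS2 g).
Proof.
move=> fM; rewrite box_dotDl box_dotDr; congr (_ + _).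
by apply: eq_bigr => j _; exact: (@sum_backshift M (f j) (g j)).
Qed.

(** Transposition exchanges the two summands of [transfer]: [addP1] after [addS2] becomes [addP2]
    after [addS1]. The support of [f] stays far enough inside the box to kill all boundary terms. *)
Lemma box_dot_transfer M f g :
  (forall j k, (M.-1 <= j) || (M.-1 <= k) -> f j k = 0) ->
  box_dot M (transfer f) g = box_dot M f (transfer g).
Proof.
move=> f0; rewrite box_dotDl box_dotDr addnC.
have leM := leq_pred M.
rewrite box_dot_addP1 ?box_dot_addP2 ?box_dot_addS1 ?box_dot_addS2 // => i;
  by rewrite /addS1 /addS2 !f0 // ?leqnn ?leqnSn ?leM ?orbT.
Qed.

Lemma box_dot_triples0 M g : box_dot M.+1 (path_triples 0) g = g 0 0.
Proof.
rewrite /box_dot big_ord_recl [X in _ + X]big1 => [|i _]; last first.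
  by rewrite big1 // => j _; rewrite mul0n.
by rewrite big_ord_recl big1 => [|i _]; rewrite /= ?mul0n // mul1n !addn0.
Qed.

(** Symmetry moves the steps of the left factor to the right one, until the left factor is the
    indicator of [(0, 0)]. *)
Lemma box_dot_triples M a b : a + b < M.-1 ->
  box_dot M (path_triples a) (path_triples b) = path_triples (a + b) 0 0.
Proof.
elim: a b => [|a IH] b abM.
  by case: M abM => [//|M] _; rewrite box_dot_triples0.
rewrite path_triplesS box_dot_transfer; last first.
  by move=> j k H; apply: path_triples_small; lia.
by rewrite -path_triplesS IH addnS.
Qed.

(* The Vandermonde product of the positions, made strictly ordered by adding
   one to each gap; it vanishes as soon as two paths cross. *)
Definition vandermonde j k := j.+1 * k.+1 * (j + k).+2.

(** A polynomial identity. It survives the cut-off in [backshift] because the product vanishes at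
    gap [-1]. *)
Lemma transfer_vandermonde j k : transfer vandermonde j k = 8 * vandermonde j k.
Proof.
rewrite /transfer /addP1 /addP2 /addS1 /addS2 /vandermonde.
by case: j k => [|j] [|k] /=; nia.
Qed.

Lemma box_dot_vandermonde M N : N < M.-1 ->
  box_dot M (path_triples N) vandermonde = 8 ^ N * 2.
Proof.
elim: N => [|N IH] NM.
  by case: M NM => [//|M] _; rewrite box_dot_triples0.
rewrite path_triplesS box_dot_transfer; last first.
  by move=> j k H; apply: path_triples_small; lia.
transitivity (8 * box_dot M (path_triples N) vandermonde).
  rewrite big_distrr; apply: eq_bigr => j _; rewrite big_distrr; apply: eq_bigr => k _ /=.
  by rewrite transfer_vandermonde mulnCA.
by rewrite IH ?expnS ?mulnA // ltnW.
Qed.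

(** * Cauchy-Schwarz and the polynomial loss *)

(** After doubling, this is [2 * (a i * a j) <= a i ^ 2 + a j ^ 2] summed over all pairs. *)
Lemma sqr_sum_leq (I : finType) (a : I -> nat) :
  (\sum_i a i) ^ 2 <= #|I| * \sum_i a i ^ 2.
Proof.
rewrite -(leq_pmul2l (isT : 0 < 2)) -mulnn big_distrlr /= big_distrr /=.
under eq_bigr => i _ do rewrite big_distrr.
have -> : 2 * (#|I| * \sum_i a i ^ 2) = \sum_i \sum_j (a i ^ 2 + a j ^ 2).
  under [RHS]eq_bigr => i _ do rewrite big_split /= sum_nat_const.
  by rewrite big_split /= sum_nat_const -big_distrr /= mul2n addnn.
by apply: leq_sum => i _; apply: leq_sum => j _; rewrite /= nat_Cauchy.
Qed.

Lemma path_triples_lower_bound m : 64 ^ m <= 4 * m.+1 ^ 8 * path_triples m.*2 0 0.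
Proof.
(* The least box in which [box_dot_triples] applies to [m + m]. *)
pose M := m.*2.+2; pose I := ('I_M * 'I_M)%type.
have mM : m < M.-1 by rewrite /M; lia.
have M2 : m + m < M.-1 by rewrite /M; lia.
pose a (s : I) := path_triples m s.1 s.2 * vandermonde s.1 s.2.
have Ea : \sum_s a s = 8 ^ m * 2 by rewrite -(box_dot_vandermonde mM) [RHS]pair_big.
(* On the support both gaps are at most [m], which bounds the Vandermonde factor by
   [2 * m.+1 ^ 3]. *)
have : \sum_s a s ^ 2 <= (2 * m.+1 ^ 3) ^ 2 * path_triples m.*2 0 0.
  rewrite -addnn -(box_dot_triples M2) [box_dot _ _ _]pair_big big_distrr /=.
  apply: leq_sum => s _; rewrite /a mulnn expnMn mulnC.
  case: (boolP ((m < s.1) || (m < s.2))) => [/path_triples_small -> |].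
    by rewrite !muln0.
  rewrite negb_or -!leqNgt => /andP[s1 s2].
  apply: leq_mul => //; rewrite leq_exp2r // /vandermonde.
  have -> : 2 * m.+1 ^ 3 = m.+1 * m.+1 * (2 * m.+1) by rewrite !expnS expn0; lia.
  by apply: leq_mul; [exact: leq_mul | lia].
move=> H; have := sqr_sum_leq a; rewrite Ea card_prod !card_ord => /leq_trans.
move=> /(_ _ (leq_mul (leqnn _) H)).
have -> : M = 2 * m.+1 by rewrite /M; lia.
rewrite (_ : 64 = 8 ^ 2) // -expnM (mulnC 2 m) expnM expnMn.
set T := path_triples _ _ _; set E := (8 ^ m) ^ 2; set k := m.+1.
rewrite (_ : _ * _ * _ = 4 * (4 * k ^ 8 * T)); last by rewrite !expnS expn0; lia.
by rewrite [X in X <= _]mulnC leq_pmul2l.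
Qed.

(** All three paths can first take one step together. *)
Lemma path_triples00_leqS N : path_triples N 0 0 <= path_triples N.+1 0 0.
Proof. by rewrite path_triplesS /transfer /addP1 /addS2 -!addnA leq_addr. Qed.

Lemma walks_lower_bound N : 8 ^ N.+1 <= 256 * N.+1 ^ 8 * walks N 0 0.
Proof.
have leq_half : N./2 <= N by lia.
have -> : walks N 0 0 = path_triples N 0 0.
  by rewrite walks_triples /binom_transform !big_ord1 bin0 !mul1n.
have oddN := odd_double_half N; set m := N./2 in oddN.
(* [N] is rounded down to the even number [2 * m]; since [N.+1 <= 2 * m + 2], this costs a factor of
   at most 64. *)
have le64 : 8 ^ N.+1 <= 64 * 64 ^ m.
  by rewrite -expnS (_ : 64 = 8 ^ 2) // -expnM leq_exp2l // -oddN; case: odd; lia.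
apply: (leq_trans le64).
apply: (leq_trans (leq_mul (leqnn 64) (path_triples_lower_bound m))).
rewrite mulnA (mulnA 64) (_ : 64 * 4 = 256) //; apply: leq_mul.
  by rewrite leq_pmul2l // leq_exp2r // ltnS; exact: leq_half.
by rewrite -oddN; case: odd => //=; exact: path_triples00_leqS.
Qed.

(** * Baxter permutations *)

Definition insert_at p m (A : seq nat) := take p A ++ m :: drop p A.

Definition lrmax A p := all (ltn^~ (nth 0 A p)) (take p A).

Definition lrsites A := [seq p <- iota 0 (size A) | lrmax A p].

(* Right-to-left maxima are handled as left-to-right maxima of the reversal. *)
Definition children A :=
  [seq insert_at p (size A) A | p <- lrsites A] ++
  [seq rev (insert_at p (size A) (rev A)) | p <- lrsites (rev A)].

(* [baxter n] lists permutations of [n + 1] values. *)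
Fixpoint baxter n :=
  if n is n'.+1 then flatten [seq children A | A <- baxter n'] else [:: [:: 0]].

Lemma size_insert p m A : size (insert_at p m A) = (size A).+1.
Proof. by rewrite size_cat /= addnS -size_cat cat_take_drop. Qed.

Lemma nth_insert p m A k : p <= size A ->
  nth 0 (insert_at p m A) k =
    if k < p then nth 0 A k else if k == p then m else nth 0 A k.-1.
Proof.
move=> pA; rewrite nth_cat size_take_min (minn_idPl pA).
case: ltngtP => [kp|pk|->]; rewrite ?nth_take ?subnn //.
by case: k pk => // k pk; rewrite subSn //= nth_drop subnKC.
Qed.

Lemma perm_insert p m A : perm_eq (insert_at p m A) (m :: A).
Proof.
by rewrite /insert_at -cat1s perm_catCA /= perm_cons cat_take_drop.
Qed.

Lemma rev_insert p m A : p <= size A ->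
  rev (insert_at p m A) = insert_at (size A - p) m (rev A).
Proof.
by move=> pA; rewrite /insert_at take_rev drop_rev subKn // rev_cat rev_cons cat_rcons.
Qed.

Lemma lrmaxP A p : p < size A ->
  reflect (forall l, l < p -> nth 0 A l < nth 0 A p) (lrmax A p).
Proof.
move=> pA; have st : size (take p A) = p by rewrite size_take_min (minn_idPl (ltnW pA)).
apply: (iffP (all_nthP 0)); rewrite st => H l lp; have := H l lp;
  by rewrite nth_take.
Qed.

Lemma lrsitesP A p :
  reflect (p < size A /\ forall l, l < p -> nth 0 A l < nth 0 A p) (p \in lrsites A).
Proof.
rewrite mem_filter mem_iota add0n leq0n /= andbC.
apply: (iffP andP) => -[pA H]; split=> //; exact/lrmaxP.
Qed.

(** Translates a site of the reversal back: the new cell lands at [p], just right of the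
    right-to-left maximum at [p.-1]. *)
Lemma lrsites_rev A m (q : nat) : q \in lrsites (rev A) ->
  let p := size A - q in
  [/\ 0 < p <= size A, forall l, p <= l < size A -> nth 0 A l < nth 0 A p.-1
    & rev (insert_at q m (rev A)) = insert_at p m A].
Proof.
move/lrsitesP; rewrite size_rev => -[qA H] p; rewrite /p; split; first by lia.
  move=> l /andP[pl lA]; have := H (size A - l.+1); rewrite !nth_rev; try lia.
  have -> : size A - (size A - l.+1).+1 = l by lia.
  have -> : size A - q.+1 = (size A - q).-1 by lia.
  by apply; lia.
by rewrite rev_insert ?size_rev ?revK // ltnW.
Qed.

(** * Record counts of the children *)

(** The new maximum is a record and hides all cells to its right, while the records before it
    survive. *)
Lemma size_lrsites_insert m A q : all (ltn^~ m) A -> q <= size A ->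
  size (lrsites (insert_at q m A)) = (count (lrmax A) (iota 0 q)).+1.
Proof.
move=> /allP Am qA; rewrite size_filter size_insert.
have -> : (size A).+1 = q + (1 + (size A - q)) by lia.
rewrite !iotaD !count_cat add0n /= addn0.
have -> : lrmax (insert_at q m A) q.
  apply/allP => y; rewrite nth_insert // ltnn eqxx take_size_cat ?size_takel //.
  by move=> /mem_take/Am.
have -> : count (lrmax (insert_at q m A)) (iota (q + 1) (size A - q)) = 0.
  apply/eqP; rewrite -leqn0 leqNgt -has_count.
  apply/(@hasPn nat) => k; rewrite mem_iota => kI.
  apply/negP; have kB : k < size (insert_at q m A) by rewrite size_insert; lia.
  have qk : q < k by lia.
  move=> /(lrmaxP kB) /(_ q qk); rewrite !nth_insert // ltnn eqxx.
  rewrite [k < q]ltnNge (ltnW qk) /= gtn_eqF // ltnNge ltnW //.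
  by apply: Am; rewrite mem_nth //; move: kB qk; rewrite size_insert; case: (k).
rewrite addn0 addn1; congr _.+1; apply: eq_in_count => k; rewrite mem_iota add0n /= => kq.
rewrite /lrmax nth_insert // kq; congr all.
rewrite take_cat size_takel // kq take_takel //; exact: ltnW.
Qed.

(** Seen from the right, the new cell hides only cells left of the record at [q], which that record
    already hides. So no record is lost and one is gained. *)
Lemma size_lrsites_rev_insert m A (q : nat) : all (ltn^~ m) A -> q \in lrsites A ->
  size (lrsites (rev (insert_at q m A))) = (size (lrsites (rev A))).+1.
Proof.
move=> Am /lrsitesP[qA qmax]; rewrite rev_insert ?(ltnW qA) //.
rewrite size_lrsites_insert ?all_rev ?size_rev ?leq_subr // size_filter size_rev.
congr _.+1; rewrite -[in RHS](subnK (ltnW qA)) iotaD count_cat add0n.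
rewrite -[LHS]addn0; congr (_ + _); apply/esym/eqP.
rewrite -leqn0 leqNgt -has_count; apply/(@hasPn nat) => k; rewrite mem_iota => kI.
apply/negP; have kB : k < size (rev A) by rewrite size_rev; lia.
move=> /(lrmaxP kB) /(_ (size A - q.+1)); rewrite !nth_rev; try lia.
have -> : size A - (size A - q.+1).+1 = q by lia.
have := qmax (size A - k.+1); lia.
Qed.

(** Reindexes the sites by rank, the number of sites before them. *)
Lemma sum_count_filter (P : pred nat) (F : nat -> nat) n :
  \sum_(p <- iota 0 n | P p) F (count P (iota 0 p)) =
  \sum_(a < count P (iota 0 n)) F a.
Proof.
elim: n => [|n IH]; first by rewrite big_nil big_ord0.
rewrite -addn1 iotaD big_cat count_cat /= IH big_cons big_nil add0n /=.
by case: (P n); rewrite ?addn0 // addn1 big_ord_recr.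
Qed.

Definition count_walks N A :=
  walks N (size (lrsites A)).-1 (size (lrsites (rev A))).-1.

Lemma size_lrsites_gt0 A : 0 < size A -> 0 < size (lrsites A).
Proof.
by case: A => // x A _; rewrite size_filter /=.
Qed.

Lemma sum_count_walks_children N A : 0 < size A -> all (ltn^~ (size A)) A ->
  \sum_(C <- children A) count_walks N C = count_walks N.+1 A.
Proof.
move=> A0 AA; have rA0 : 0 < size (rev A) by rewrite size_rev.
have rAA : all (ltn^~ (size A)) (rev A) by rewrite all_rev.
have [x0 y0] := (size_lrsites_gt0 A0, size_lrsites_gt0 rA0).
rewrite big_cat !big_map /count_walks /= !prednK //; congr (_ + _).
  rewrite [in RHS]size_filter -(sum_count_filter _ (fun a => walks N a _)).
  rewrite -[RHS]big_filter.
  rewrite big_seq [RHS]big_seq; apply: eq_bigr => p pA.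
  have [/ltnW pA' _] := lrsitesP _ _ pA.
  by rewrite size_lrsites_insert // size_lrsites_rev_insert.
rewrite [in RHS](size_filter _ (iota 0 (size (rev A)))).
rewrite -(sum_count_filter _ (fun a => walks N _ a)) -[RHS]big_filter.
rewrite big_seq [RHS]big_seq; apply: eq_bigr => p pA.
have [/ltnW pA' _] := lrsitesP _ _ pA.
by rewrite revK size_lrsites_insert // size_lrsites_rev_insert // revK.
Qed.

Lemma perm_children A C : C \in children A -> perm_eq C (size A :: A).
Proof.
rewrite mem_cat => /orP[] /mapP[p _ ->]; first exact: perm_insert.
by rewrite perm_rev (perm_trans (perm_insert _ _ _)) // perm_cons perm_rev.
Qed.

Lemma perm_baxter n A : A \in baxter n -> perm_eq A (iota 0 n.+1).
Proof.
elim: n A => [|n IH] A; first by rewrite inE => /eqP ->.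
move=> /flatten_mapP[B /IH pB /perm_children pA].
apply: (perm_trans pA); rewrite (perm_size pB) size_iota.
rewrite -[in X in perm_eq _ X](addn1 n.+1) iotaD cats1 perm_sym.
by rewrite perm_rcons perm_cons perm_sym.
Qed.

Lemma size_baxter_elt n A : A \in baxter n -> size A = n.+1.
Proof. by move=> /perm_baxter/perm_size; rewrite size_iota. Qed.

Lemma all_baxter_elt n A : A \in baxter n -> all (ltn^~ n.+1) A.
Proof.
move=> /perm_baxter pA; apply/allP => x.
by rewrite (perm_mem pA) mem_iota.
Qed.

Lemma size_baxter n : size (baxter n) = walks n 0 0.
Proof.
(* The induction needs the count of descendants [N] generations later; [N = 0] gives the size. *)
have sumE N k : \sum_(A <- baxter k) count_walks N A = walks (N + k) 0 0.
  elim: k N => [|k IH] N; first by rewrite /= big_seq1 addn0.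
  rewrite addnS -addSn -IH big_flatten big_map big_seq [RHS]big_seq.
  apply: eq_bigr => A Ak; apply: sum_count_walks_children.
    by rewrite (size_baxter_elt Ak).
  by rewrite (size_baxter_elt Ak) (all_baxter_elt Ak).
by rewrite -[n in RHS]add0n -sumE sum1_size.
Qed.

(** * Distinctness of the listed permutations *)

(** The map [g] reads the parent off a child, so the blocks are disjoint. For permutations, [g]
    deletes the largest value. *)
Lemma uniq_flatten_map (S T : eqType) (f : S -> seq T) (g : T -> S) (s : seq S) :
  uniq s -> {in s, forall x, uniq (f x)} ->
  {in s, forall x, {in f x, forall y, g y = x}} -> uniq (flatten (map f s)).
Proof.
elim: s => //= x s IH /andP[xs us] uf gf.
rewrite cat_uniq uf ?mem_head //= IH //; last 2 first.
- by move=> y ys; apply: uf; rewrite inE ys orbT.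
- by move=> y ys; apply: gf; rewrite inE ys orbT.
rewrite andbT; apply/hasPn => z /flatten_mapP[y ys zy]; apply/negP => zx.
move: xs; rewrite -(gf x (mem_head _ _) z zx) (gf y _ z zy) ?ys //.
by rewrite inE ys orbT.
Qed.

Lemma insert_inj m A p q : m \notin A -> p <= size A -> q <= size A ->
  insert_at p m A = insert_at q m A -> p = q.
Proof.
move=> mA.
have idx r : r <= size A -> index m (insert_at r m A) = r.
  move=> rA; rewrite index_cat (negbTE (contra (@mem_take _ _ _ _) mA)) /= eqxx addn0.
  by rewrite size_takel.
by move=> pA qA E; rewrite -(idx p pA) E idx.
Qed.

Lemma uniq_children A : all (ltn^~ (size A)) A -> uniq (children A).
Proof.
move=> /allP AA; have nA : size A \notin A by apply/negP => /AA; rewrite /= ltnn.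
have nrA : size A \notin rev A by rewrite mem_rev.
rewrite cat_uniq !map_inj_in_uniq ?filter_uniq ?iota_uniq //=; last 2 first.
- move=> p q /lrsitesP[/ltnW pA _] /lrsitesP[/ltnW qA _] /(can_inj revK).
  exact: insert_inj.
- by move=> p q /lrsitesP[/ltnW pA _] /lrsitesP[/ltnW qA _]; exact: insert_inj.
(* A child of both kinds would make each of the cells [p.-1] and [p] of [A] exceed the other. *)
rewrite andbT; apply/hasPn => C /mapP[q /(lrsites_rev (size A))[qI qmax ->] ->].
apply/negP => /mapP[p /lrsitesP[pA pmax]] /insert_inj E.
move: (E nA (proj2 (andP qI)) (ltnW pA)) => Eq.
rewrite Eq in qI qmax; have := qmax p; rewrite leqnn pA => /(_ isT).
by rewrite ltnNge ltnW // pmax // prednK //; case/andP: qI.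
Qed.

Lemma filter_children A C : all (ltn^~ (size A)) A -> C \in children A ->
  [seq x <- C | x < size A] = A.
Proof.
move=> AA.
have fA p : [seq x <- insert_at p (size A) A | x < size A] = A.
  rewrite filter_cat /= ltnn -filter_cat cat_take_drop; exact/all_filterP.
rewrite mem_cat => /orP[] /mapP[p pA ->] //.
by have [_ _ ->] := lrsites_rev (size A) pA.
Qed.

Lemma uniq_baxter n : uniq (baxter n).
Proof.
elim: n => //= n IH; apply: (@uniq_flatten_map _ _ _ (fun C => [seq x <- C | x < n.+1])) => // A An.
  by rewrite uniq_children // (size_baxter_elt An) (all_baxter_elt An).
move=> C; have := @filter_children A C.
rewrite (size_baxter_elt An); apply; exact: all_baxter_elt.
Qed.

(** * Reconstruction from range extrema *)

(** What equal codes yield: each query has an answer that is correct for both arrays. *)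
Definition common_extrema n (u v : nat -> nat) := forall i j, i <= j < n ->
  (exists2 k, i <= k <= j & forall l, i <= l <= j -> u k <= u l /\ v k <= v l) /\
  (exists2 k, i <= k <= j & forall l, i <= l <= j -> u l <= u k /\ v l <= v k).

Lemma common_extrema_sym n u v : common_extrema n u v -> common_extrema n v u.
Proof.
move=> H i j /H[[k kI kP] [k' kI' kP']].
by split; [exists k | exists k'] => // l; [move/kP | move/kP'] => -[].
Qed.

Lemma common_extrema_rev A B : size A = size B ->
  common_extrema (size A) (nth 0 A) (nth 0 B) ->
  common_extrema (size A) (nth 0 (rev A)) (nth 0 (rev B)).
Proof.
move=> sAB H i j /andP[ij jA].
have /H : size A - j.+1 <= size A - i.+1 < size A by lia.
move=> [[k kI kP] [k' kI' kP']].
split; [exists (size A - k.+1); first lia | exists (size A - k'.+1); first lia] => l lI;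
  rewrite !nth_rev -?sAB; try lia.
- have := kP (size A - l.+1); rewrite (_ : size A - (size A - k.+1).+1 = k); last lia.
  by apply; lia.
- have := kP' (size A - l.+1); rewrite (_ : size A - (size A - k'.+1).+1 = k'); last lia.
  by apply; lia.
Qed.

Lemma all_nth_lt m A l : all (ltn^~ m) A -> l < size A -> nth 0 A l < m.
Proof. by move=> /allP Am lA; apply: Am; rewrite mem_nth. Qed.

(** The maximum query on the whole array locates the inserted cell. *)
Lemma common_extrema_insert_site n A B p q :
  size A = n -> size B = n -> all (ltn^~ n) A -> all (ltn^~ n) B ->
  p <= n -> q <= n ->
  common_extrema n.+1 (nth 0 (insert_at p n A)) (nth 0 (insert_at q n B)) -> p = q.
Proof.
move=> sA sB AA BB pn qn /(_ 0 n)[]; first by rewrite leq0n ltnSn.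
move=> _ [k kn kP].
have peak C r : size C = n -> all (ltn^~ n) C -> r <= n ->
    n <= nth 0 (insert_at r n C) k -> k = r.
  move=> sC CC rn; rewrite nth_insert ?sC //.
  by case: ltngtP => // kr; rewrite leqNgt all_nth_lt ?sC //; lia.
have top C r : size C = n -> r <= n -> nth 0 (insert_at r n C) r = n.
  by move=> sC rn; rewrite nth_insert ?sC // ltnn eqxx.
transitivity k; [apply/esym/(peak A) => // | apply/(peak B) => //].
  by have [] := kP p pn; rewrite top.
by have [_] := kP q qn; rewrite top.
Qed.

Lemma common_extrema_insert n A B (p : nat) :
  size A = n -> size B = n -> all (ltn^~ n) A -> all (ltn^~ n) B ->
  p \in lrsites A -> p \in lrsites B ->
  common_extrema n.+1 (nth 0 (insert_at p n A)) (nth 0 (insert_at p n B)) ->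
  common_extrema n (nth 0 A) (nth 0 B).
Proof.
move=> sA sB AA BB /lrsitesP[pA pmaxA] /lrsitesP[_ pmaxB] H i j /andP[ij jn].
rewrite sA in pA; have pn := ltnW pA.
(* [up] skips the inserted cell; [down] undoes it away from [p]. *)
pose up k := if k < p then k else k.+1.
pose down k := if k < p then k else k.-1.
have insE C l : size C = n -> nth 0 (insert_at p n C) (up l) = nth 0 C l.
  move=> sC; rewrite nth_insert ?sC // /up.
  by case: (ltnP l p) => lp /=; [rewrite lp | rewrite ltnNge leqW //= gtn_eqF].
have insD C k : size C = n -> k != p -> nth 0 (insert_at p n C) k = nth 0 C (down k).
  by move=> sC kp; rewrite nth_insert ?sC // (negbTE kp) /down; case: ifP.
have insp C : size C = n -> nth 0 (insert_at p n C) p = n.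
  by move=> sC; rewrite nth_insert ?sC // ltnn eqxx.
have upP k : k < p /\ up k = k \/ p <= k /\ up k = k.+1.
  by rewrite /up; case: ltnP; [left | right].
have downP k : k < p /\ down k = k \/ p <= k /\ down k = k.-1.
  by rewrite /down; case: ltnP; [left | right].
split.
  have /H[[k kI kP] _] : up i <= up j < n.+1 by have := upP i; have := upP j; lia.
  (* The new maximum is never a minimum, as the range also contains the older cell [up i]. *)
  have kp : k != p.
    apply/eqP => kp; subst k.
    have [] := kP (up i); first by have := upP i; have := upP j; lia.
    by rewrite insp // insE // leqNgt all_nth_lt // sA; lia.
  exists (down k) => [|l lI].
    by have := upP i; have := upP j; have := downP k; lia.
  have := kP (up l); rewrite !insE // !insD //; apply.
  by have := upP i; have := upP j; have := upP l; lia.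
(* A maximum query across the new cell would only return that cell. Such a range is cut to start
   just after it, at the old record [p], which dominates all cells dropped on the left. *)
pose i' := if j < p then i else maxn i p.
have i'P : j < p /\ i' = i \/ p <= j /\ i' = maxn i p.
  by rewrite /i'; case: ltnP; [left | right].
have /H[_ [k kI kP]] : up i' <= up j < n.+1.
  by have := upP i'; have := upP j; lia.
have kp : k != p by have := upP i'; have := upP j; lia.
exists (down k) => [|l lI].
  by have := upP i'; have := upP j; have := downP k; lia.
have [/andP[pj lp]|pl] := boolP ((p <= j) && (l < p)); last first.
  have := kP (up l); rewrite !insE // !insD //; apply.
  by have := upP i'; have := upP j; have := upP l; lia.
have := kP (up p); rewrite !insE // !insD // => -[].
  by have := upP i'; have := upP j; have := upP p; lia.
have := pmaxA l lp; have := pmaxB l lp.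
move=> lB lA pkA pkB.
by split; [exact: leq_trans (ltnW lA) pkA | exact: leq_trans (ltnW lB) pkB].
Qed.

Lemma children_inj n A B C D :
  size A = n -> size B = n -> all (ltn^~ n) A -> all (ltn^~ n) B ->
  C \in children A -> D \in children B ->
  common_extrema n.+1 (nth 0 C) (nth 0 D) ->
  common_extrema n (nth 0 A) (nth 0 B) /\ (A = B -> C = D).
Proof.
(* The maximum was inserted next to a left-to-right maximum in one array and next
   to a right-to-left maximum in the other: the minimum of the three cells around
   it lies on opposite sides. *)
have mixed A' B' (p q : nat) : size A' = n -> size B' = n ->
    all (ltn^~ n) A' -> all (ltn^~ n) B' ->
    p \in lrsites A' -> q \in lrsites (rev B') ->
    ~ common_extrema n.+1 (nth 0 (insert_at p n A'))
        (nth 0 (rev (insert_at q n (rev B')))).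
  move=> sA sB AA BB /lrsitesP[pA pmax] /(lrsites_rev n)[qI qmax ->] H.
  have Eq : p = size B' - q.
    by apply: common_extrema_insert_site H; rewrite // -?sA -?sB; lia.
  rewrite -Eq in qI qmax H.
  have /H[[k kI kP] _] : p.-1 <= p.+1 < n.+1 by lia.
  have p0 : 0 < p by case/andP: qI.
  have pn : p <= n by rewrite -sA ltnW.
  have at_pred E : size E = n -> nth 0 (insert_at p n E) p.-1 = nth 0 E p.-1.
    by move=> sE; rewrite nth_insert ?sE // prednK // leqnn.
  have at_site E : size E = n -> nth 0 (insert_at p n E) p = n.
    by move=> sE; rewrite nth_insert ?sE // ltnn eqxx.
  have at_succ E : size E = n -> nth 0 (insert_at p n E) p.+1 = nth 0 E p.
    by move=> sE; rewrite nth_insert ?sE // ltnNge leqnSn gtn_eqF.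
  have Ap : nth 0 A' p.-1 < nth 0 A' p by apply: pmax; rewrite prednK.
  have Bp : nth 0 B' p < nth 0 B' p.-1 by apply: qmax; rewrite leqnn sB -sA.
  have An : nth 0 A' p.-1 < n by rewrite all_nth_lt // sA; lia.
  have [p_lo p_hi] : p.-1 <= p.-1 <= p.+1 /\ p.-1 <= p.+1 <= p.+1 by lia.
  have [kA _] := kP _ p_lo; have [_ kB] := kP _ p_hi.
  move: kA kB; rewrite at_pred // at_succ //.
  have [->|->|->] : [\/ k = p.-1, k = p | k = p.+1].
  - have [kp|kp|kp] := ltngtP k p; [apply: Or31 | apply: Or33 | exact: Or32]; lia.
  - by rewrite !at_pred // => _; rewrite leqNgt Bp.
  - by rewrite !at_site // leqNgt An.
  - by rewrite !at_succ // leqNgt Ap.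
move=> sA sB AA BB; rewrite !mem_cat sA sB.
have [srA srB] : size (rev A) = n /\ size (rev B) = n by rewrite !size_rev.
have [rAA rBB] : all (ltn^~ n) (rev A) /\ all (ltn^~ n) (rev B) by rewrite !all_rev.
case/orP => /mapP[p pA ->]; case/orP => /mapP[q qB ->] H.
- have [pn _] := lrsitesP _ _ pA; have [qn _] := lrsitesP _ _ qB.
  rewrite sA in pn; rewrite sB in qn.
  have pq := common_extrema_insert_site sA sB AA BB (ltnW pn) (ltnW qn) H.
  by subst q; split=> [|-> //]; exact: common_extrema_insert H.
- by case: (mixed _ _ _ _ sA sB AA BB pA qB H).
- by case: (mixed _ _ _ _ sB sA BB AA qB pA (common_extrema_sym H)).
have [pn _] := lrsitesP _ _ pA; have [qn _] := lrsitesP _ _ qB.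
rewrite srA in pn; rewrite srB in qn.
(* Reversal reduces two insertions on the right to the case already treated. *)
have {}H : common_extrema n.+1 (nth 0 (insert_at p n (rev A)))
    (nth 0 (insert_at q n (rev B))).
  move: (@common_extrema_rev (rev (insert_at p n (rev A))) (rev (insert_at q n (rev B)))).
  by rewrite !revK !(size_rev, size_insert) sA sB; apply.
have pq := common_extrema_insert_site srA srB rAA rBB (ltnW pn) (ltnW qn) H.
subst q; split=> [|-> //].
have := common_extrema_insert srA srB rAA rBB pA qB H.
by have := @common_extrema_rev (rev A) (rev B); rewrite !revK srA srB; apply.
Qed.

Lemma baxter_inj n A B : A \in baxter n -> B \in baxter n ->
  common_extrema n.+1 (nth 0 A) (nth 0 B) -> A = B.
Proof.
elim: n A B => [|n IH] A B; first by rewrite !inE => /eqP-> /eqP->.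
move=> /flatten_mapP[A' A'n AA'] /flatten_mapP[B' B'n BB'] H.
have [H' ->] // := children_inj (size_baxter_elt A'n) (size_baxter_elt B'n)
  (all_baxter_elt A'n) (all_baxter_elt B'n) AA' BB' H.
exact: IH.
Qed.

(** * Encodings *)

(** Codes may differ in length and need not be prefix-free, so all words of at most [L] bits are
    listed. *)
Fixpoint short_words L : seq (seq bool) :=
  if L is L'.+1 then
    [::] :: [seq true :: w | w <- short_words L'] ++
            [seq false :: w | w <- short_words L']
  else [:: [::]].

Lemma mem_short_words L w : size w <= L -> w \in short_words L.
Proof.
elim: L w => [|L IH] [|b w] //= /IH wL.
by rewrite inE mem_cat; apply/orP; right; case: b; rewrite map_f ?orbT.
Qed.

Lemma size_short_words L : (size (short_words L)).+1 = 2 ^ L.+1.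
Proof.
elim: L => //= L IH; rewrite size_cat !size_map expnS -IH; lia.
Qed.

Lemma ex_argmax (S : eqType) (F : S -> nat) (s : seq S) : 0 < size s ->
  exists2 x, x \in s & {in s, forall y, F y <= F x}.
Proof.
elim: s => // x [|x' s] IH _.
  by exists x; rewrite ?mem_head // => y; rewrite inE => /eqP->.
have [//|z zs zmax] := IH.
case: (leqP (F x) (F z)) => xz.
  exists z; first by rewrite inE zs orbT.
  by move=> y; rewrite inE => /orP[/eqP->|/zmax].
exists x; first exact: mem_head.
by move=> y; rewrite inE => /orP[/eqP->|/zmax yz] //; exact: leq_trans yz (ltnW xz).
Qed.

(** Sorting the distinct values of [v] gives a copy of [0..n] in [T], in which permutations can be
    written. *)
Lemma increasing_of_injective {d : Order.disp_t} {T : orderType d} n (v : 'I_n.+1 -> T) :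
  injective v -> exists e : nat -> T,
    forall i j, i < n.+1 -> j < n.+1 -> (e i <= e j)%O = (i <= j).
Proof.
move=> v_inj; pose s := sort <=%O (codom v).
have s_lt : sorted <%O s by rewrite sort_lt_sorted; exact/injectiveP.
have s_size : size s = n.+1 by rewrite size_sort size_codom card_ord.
exists (nth (v ord0) s) => i j iN jN.
by apply: (lt_sorted_leq_nth (v ord0) s_lt); rewrite inE s_size.
Qed.

Lemma encoding_lower_bound {d : Order.disp_t} {T : orderType d} n
    (v : 'I_n.+1 -> T) (enc : n.+1.-tuple T -> seq bool) :
  injective v -> range_min_max_encoding enc ->
  exists A, 8 ^ n.+1 <= 512 * n.+1 ^ 8 * 2 ^ size (enc A).
Proof.
move=> /increasing_of_injective[e e_mono] [qmin [qmax qP]].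
pose arr (s : seq nat) := [tuple e (nth 0 s i) | i < n.+1].
have arr_le s (k l : 'I_n.+1) : s \in baxter n ->
    (tnth (arr s) k <= tnth (arr s) l)%O = (nth 0 s k <= nth 0 s l).
  move=> sn; have s_lt (i : 'I_n.+1) : nth 0 s i < n.+1.
    by apply: all_nth_lt; rewrite ?(size_baxter_elt sn) //; exact: all_baxter_elt sn.
  by rewrite !tnth_mktuple e_mono.
have enc_inj : {in baxter n &, injective (enc \o arr)}.
  move=> s t sn tn /= Eenc; apply: (baxter_inj sn tn) => i j /andP[ij jn].
  pose i' := Ordinal (leq_ltn_trans ij jn); pose j' := Ordinal jn.
  have [[sI smin] [sI' smax]] := qP (arr s) i' j' ij.
  have [[_ tmin] [_ tmax]] := qP (arr t) i' j' ij.
  rewrite -Eenc in tmin tmax.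
  split; [exists (qmin (enc (arr s)) i' j') => // l /andP[il lj] |
          exists (qmax (enc (arr s)) i' j') => // l /andP[il lj]];
  pose l' := Ordinal (leq_ltn_trans lj jn).
  - have lI : (i' <= l' <= j') by rewrite /= il lj.
    have := smin l' lI; have := tmin l' lI; rewrite !arr_le //=.
  - have lI : (i' <= l' <= j') by rewrite /= il lj.
    have := smax l' lI; have := tmax l' lI; rewrite !arr_le //=.
have lb : 8 ^ n.+1 <= 256 * n.+1 ^ 8 * size (baxter n).
  by rewrite size_baxter walks_lower_bound.
have bn0 : 0 < size (baxter n).
  rewrite lt0n; apply/eqP => b0; move: lb; rewrite b0 muln0 leqn0 expn_eq0 //.
(* The witness is the array with the longest code: all codes fit in its length [L], so there are
   fewer than [2 ^ L.+1] of them. *)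
have [s sn smax] := @ex_argmax _ (fun s => size (enc (arr s))) _ bn0.
exists (arr s); set L := size (enc (arr s)).
have bL : size (baxter n) <= 2 ^ L.+1.
  rewrite -size_short_words -(size_map (enc \o arr)); apply: leqW.
  apply: uniq_leq_size; first by rewrite map_inj_in_uniq // uniq_baxter.
  by move=> w /mapP[t tn ->]; apply: mem_short_words; exact: smax.
apply: (leq_trans lb); rewrite (_ : 512 = 256 * 2) //.
by rewrite (mulnAC 256 2) -(mulnA _ 2) -expnS leq_mul.
Qed.

(** * The asymptotic bound *)

Local Open Scope classical_set_scope.
Local Open Scope ring_scope.

Lemma eqTheta_scale (R : realType) (c : R) (g : nat -> R) : 0 < c ->
  (fun n => c * g n) =Theta_\oo g.
Proof.
move=> c0; rewrite eqThetaE qualifE; apply/asboolP.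
exists (c, c); first by rewrite /= c0.
by near=> n; rewrite normrM (gtr0_norm c0).
Unshelve. all: by end_near. Qed.

Theorem theorem2 (R : realType) :
  exists f : nat -> R,
    f =Theta_\oo (fun n : nat => ln (n%:R : R)) /\
    \forall n \near \oo,
      forall (d : Order.disp_t) (T : orderType d),
        (exists v : 'I_n -> T, injective v) ->
        forall enc : n.-tuple T -> seq bool,
          range_min_max_encoding enc ->
          exists A : n.-tuple T, 3 * n%:R - f n <= (size (enc A))%:R.
Proof.
have ln2 : 0 < ln (2 : R) by apply: ln_gt0; rewrite ltr1n.
(* [11 = 8 + 3]: the polynomial loss has degree 8, and the constant [512 = 8 ^ 3] is absorbed into a
   cube once [n >= 8]. Dividing by [ln 2] converts to bits. *)
exists (fun n => 11 / ln 2 * ln n%:R); split.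
  by apply: eqTheta_scale; rewrite divr_gt0.
exists 8%N => // n /= n8 d T [v v_inj] enc encP.
case: n n8 v v_inj enc encP => // n n8 v v_inj enc encP.
have [A bound] := encoding_lower_bound v_inj encP; exists A.
set L := size (enc A) in bound *.
have {}bound : (2 ^ (3 * n.+1) <= n.+1 ^ 11 * 2 ^ L)%N.
  rewrite expnM; apply: (leq_trans bound).
  rewrite leq_mul2r (expnD _ 3 8) leq_mul2r.
  by rewrite (_ : 512 = 8 ^ 3)%N // leq_exp2r // n8 !orbT.
have : ln ((2 ^ (3 * n.+1))%:R : R) <= ln ((n.+1 ^ 11 * 2 ^ L)%:R : R).
  by rewrite ler_ln ?posrE ?ltr0n ?muln_gt0 ?expn_gt0 // ler_nat.
have n_pos : 0 < n.+1%:R :> R by rewrite ltr0n.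
rewrite natrM lnM ?posrE ?ltr0n ?expn_gt0 // !natrX !lnXn //.
rewrite -(mulr_natl (ln 2) (3 * n.+1)%N) -(mulr_natl (ln 2) L).
rewrite -(mulr_natl (ln n.+1%:R) 11) natrM => H.
have Ef : 11 / ln 2 * ln n.+1%:R * ln 2 = 11 * ln n.+1%:R :> R.
  by rewrite mulrAC divfK ?gt_eqF.
by rewrite lerBlDl -(ler_pM2r ln2) [X in _ <= X]mulrDl Ef.
Qed.
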